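(* Consider the deterministic setting, in which the oracle returns the exact subgradient $\boldsymbol g(\boldsymbol w)$. Suppose that the minimum of $F$ over $\mathcal{W}$ is attained and the set $\mathcal{W}^*$ of minimizers is closed; that there is a constant $G<\infty$ with $\lVert \boldsymbol g(\boldsymbol w)\rVert\le G$ for all $\boldsymbol w\in\mathcal{W}$; and that there is a constant $L_P>0$ such that for every $\boldsymbol w\in\mathcal{W}$, $F(\boldsymbol w)-F^*\ge L_P\lVert \boldsymbol w-\boldsymbol w^*\rVert$, where $\boldsymbol w^*$ denotes the point of $\mathcal{W}^*$ closest to $\boldsymbol w$. Suppose also that $F$ is Lipschitz on $\mathcal{W}$ with constant $H>0$, i.e. $|F(\boldsymbol w)-F(\boldsymbol w')|\le H\lVert\boldsymbol w-\boldsymbol w'\rVert$ for all $\boldsymbol w,\boldsymbol w'\in\mathcal{W}$, and that $0<Z<\infty$ satisfies $\lVert\boldsymbol w_0-\boldsymbol w_0^*\rVert\le Z$. Let $M$ be a positive integer. Then the final vector $\boldsymbol w_{[M+1]}$ produced by the frame-based algorithm run over $M$ frames satisfies $$\lVert\boldsymbol w_{[M+1]}-\boldsymbol w_{[M+1]}^*\rVert\le\theta\,2^{-M},\qquad F(\boldsymbol w_{[M+1]})-F^*\le\theta H\,2^{-M}.$$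
   Context: Setting: $\mathcal{W}\subseteq\mathbb{R}^N$ is a closed convex set with Euclidean norm $\lVert\cdot\rVert$ and inner product $\langle\cdot,\cdot\rangle$. $F:\mathcal{W}\to\mathbb{R}$ is continuous and convex. $F^*=\inf_{\boldsymbol w\in\mathcal{W}}F(\boldsymbol w)$ and $\mathcal{W}^*=\{\boldsymbol w\in\mathcal{W}:F(\boldsymbol w)=F^*\}$. For each $\boldsymbol w\in\mathcal{W}$, $\boldsymbol g(\boldsymbol w)$ is a subgradient: $F(\boldsymbol w')\ge F(\boldsymbol w)+\langle \boldsymbol g(\boldsymbol w),\boldsymbol w'-\boldsymbol w\rangle$ for all $\boldsymbol w'\in\mathcal{W}$. For any vector $\boldsymbol w_t$ or $\boldsymbol w_{[i]}$ in $\mathcal{W}$, the starred vector $\boldsymbol w_t^*$ or $\boldsymbol w_{[i]}^*$ is the unique point of $\mathcal{W}^*$ closest to it. Constants: $B_P=\max\left[\frac{L_P}{2},\frac{G^2}{L_P}\right]$, $r_P=\frac{3L_P}{24G^2+2L_PG}$, $\rho_P=1-\frac{3L_P^2}{4(24G^2+2L_PG)}$, $D_P=\frac{(e^{2Gr_P}-\rho_P)e^{r_PB_P}}{1-\rho_P}$, $U_P=\frac{2(D_P+1)}{r_P^2}$, $\theta=\max[\sqrt{U_P},Z]$, and the frame size is $T=\left\lceil\frac{2r_P\theta}{\log(1/\rho_P)}\right\rceil$. Frame-based algorithm: $\boldsymbol w_0\in\mathcal{W}$ is given and $\boldsymbol w_{[1]}=\boldsymbol w_0$. For each frame $i\in\{1,\dots,M\}$,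 set the step size $\alpha_{[i]}=2^{-i}$ and, starting from $\boldsymbol w_{[i]}$, perform $T$ rounds of the update $\boldsymbol w\leftarrow\Pi_{\mathcal{W}}[\boldsymbol w-\alpha_{[i]}\boldsymbol g(\boldsymbol w)]$, where $\Pi_{\mathcal{W}}$ is Euclidean projection onto $\mathcal{W}$; $\boldsymbol w_{[i+1]}$ is the vector obtained after these $T$ rounds. *)

(* Defs.v *)
From mathcomp Require Import all_boot all_order all_algebra.
From mathcomp Require Import all_classical all_reals all_analysis.

Set Implicit Arguments.
Unset Strict Implicit.
Unset Printing Implicit Defensive.
Import Order.TTheory GRing.Theory Num.Theory.
Import numFieldNormedType.Exports.

Local Open Scope classical_set_scope.
Local Open Scope ring_scope.

Section Euclidean.
Context {R : realType} {N : nat}.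
Implicit Types (u v x : 'rV[R]_N) (A : set 'rV[R]_N).

Definition dot u v : R := \sum_(i < N) u 0 i * v 0 i.

(* The library norm on matrices is the sup norm, hence this separate Euclidean
   norm; the two induce the same topology. *)
Definition enorm u : R := Num.sqrt (dot u u).

Definition closest A x : set 'rV[R]_N :=
  [set p | A p /\ forall q, A q -> enorm (x - p) <= enorm (x - q)].

(* When A is nonempty, closed and convex, closest A x is a singleton and
   proj_onto A x is its element; the default value x is then irrelevant. *)
Definition proj_onto A x : 'rV[R]_N := xget x (closest A x).

End Euclidean.

Section Optimization.
Context {R : realType} {N : nat}.
Implicit Types (W : set 'rV[R]_N) (F : 'rV[R]_N -> R).
Implicit Types (g : 'rV[R]_N -> 'rV[R]_N).

Definition min_attained W F :=
  exists2 w, W w & forall w', W w' -> F w <= F w'.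

Definition Fmin W F : R := inf (F @` W).

Definition minimizers W F : set 'rV[R]_N := [set w | W w /\ F w = Fmin W F].

Definition subgradient_on W F g :=
  forall w w', W w -> W w' -> F w + dot (g w) (w' - w) <= F w'.

Definition psg_step W g (alpha : R) (w : 'rV[R]_N) : 'rV[R]_N :=
  proj_onto W (w - alpha *: g w).

(* frames W g T w0 k is w_[k+1], the vector reached after the first k frames;
   frame k+1 has step size 2^-(k+1). *)
Fixpoint frames W g (T : nat) (w0 : 'rV[R]_N) (k : nat) : 'rV[R]_N :=
  if k is k'.+1 then iter T (psg_step W g (2 ^- k'.+1)) (frames W g T w0 k')
  else w0.

End Optimization.

Section Constants.
Context {R : realType}.
Variables L_P G Z : R.

Definition B_P : R := Num.max (L_P / 2) (G ^+ 2 / L_P).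

Definition r_P : R := 3 * L_P / (24 * G ^+ 2 + 2 * L_P * G).

Definition rho_P : R :=
  1 - 3 * L_P ^+ 2 / (4 * (24 * G ^+ 2 + 2 * L_P * G)).

Definition D_P : R :=
  (expR (2 * G * r_P) - rho_P) * expR (r_P * B_P) / (1 - rho_P).

Definition U_P : R := 2 * (D_P + 1) / r_P ^+ 2.

Definition theta : R := Num.max (Num.sqrt U_P) Z.

(* The argument of the ceiling is nonnegative in the intended range
   0 < rho_P < 1, so taking the absolute value only casts to nat. *)
Definition frame_size : nat :=
  `|Num.ceil (2 * r_P * theta / ln (rho_P^-1))|%N.

End Constants.

(* Main.v *)
Require Import Defs.
From mathcomp Require Import all_boot all_order all_algebra.
From mathcomp Require Import all_classical all_reals all_analysis.
From mathcomp Require Import lra ring.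
Import Order.TTheory GRing.Theory Num.Theory.
Import numFieldNormedType.Exports.
Local Open Scope classical_set_scope.
Local Open Scope ring_scope.

(** Let [d w] be the Euclidean distance from [w] to the set of minimizers and
    write [L] for [L_P].  Projecting onto the convex set [W] does not increase
    the distance to a point of [W] ([enorm_closest_sub_le]); together with the
    subgradient inequality, the bound [G] on the subgradients and the sharp
    growth of [F], this gives for a step of size [a] from [w] to [w']
    [[ d w' ^ 2 <= d w ^ 2 - 2 a L d w + (a G) ^ 2 ]]
    ([sqr_dist_psg_step_le]).  The right-hand side cannot be negative, for any
    [a]; choosing [a = d w / L] shows that [L <= G] as soon as some point of [W]
    is not a minimizer ([sharp_slope_le]).  Otherwise [d] vanishes on [W] and
    the bound is trivial.

    When [L <= G], the inequality says that a step either reduces the distance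
    by at least [a L / 2], or ends within [a G ^ 2 / L] of the minimizers
    ([sharp_step_le]).  Hence after [T] steps
    [[ d <= max (a G ^ 2 / L) (d_0 - T a L / 2) ]]
    and a frame starting at distance [2 a theta] ends at distance [a theta]
    whenever [G ^ 2 / L <= theta] and [2 theta / L <= T] ([dist_frame_le]).
    Halving the step size from one frame to the next turns this into the
    announced geometric decay ([dist_frames_le]).

    The constants satisfy both requirements with room to spare.  As
    [r_P <= L / (8 G ^ 2)], the bound [theta ^ 2 >= U_P >= 2 / r_P ^ 2] is far
    above [(G ^ 2 / L) ^ 2] ([theta_ge]); and [1 - rho_P = L r_P / 4] is small,
    so that [ln (1 / rho_P) <= L r_P], which is the lower bound on the frame
    size ([frame_size_ge]).  The gap in [F] follows from the distance by the
    Lipschitz bound. *)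

(** * Euclidean geometry and projections *)

Section EuclideanGeometry.
Local Set Implicit Arguments.
Local Unset Strict Implicit.
Context {R : realType} {N : nat}.
Implicit Types (u v x p q : 'rV[R]_N) (A : set 'rV[R]_N).

Lemma dot_ge0 u : 0 <= dot u u.
Proof. by apply: sumr_ge0 => i _; rewrite -expr2 sqr_ge0. Qed.

Lemma enorm_ge0 u : 0 <= enorm u.
Proof. exact: sqrtr_ge0. Qed.

Lemma sqr_enorm u : enorm u ^+ 2 = dot u u.
Proof. by rewrite sqr_sqrtr ?dot_ge0. Qed.

Lemma ler_enorm u v : (enorm u <= enorm v) = (dot u u <= dot v v).
Proof. by rewrite ler_sqrt ?dot_ge0. Qed.

Lemma dot_subC u p q : dot u (p - q) = - dot u (q - p).
Proof.
by rewrite /dot -sumrN; apply: eq_bigr => i _; rewrite !mxE; ring.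
Qed.

Lemma enorm_subC p q : enorm (p - q) = enorm (q - p).
Proof.
by congr Num.sqrt; apply: eq_bigr => i _; rewrite !mxE; ring.
Qed.

Lemma dotC u v : dot u v = dot v u.
Proof. by apply: eq_bigr => i _; rewrite mulrC. Qed.

Lemma sqr_dot_subZ (a : R) u v :
  dot (u - a *: v) (u - a *: v) = dot u u - 2 * a * dot u v + a ^+ 2 * dot v v.
Proof.
rewrite /dot !mulr_sumr -sumrN -!big_split; apply: eq_bigr => i _ /=.
by rewrite !mxE; ring.
Qed.

Lemma ler_coord_enorm u i : `|u 0 i| <= enorm u.
Proof.
rewrite -sqrtr_sqr ler_sqrt ?dot_ge0// /dot (bigD1 i)//= expr2 lerDl.
by apply: sumr_ge0 => j _; rewrite -expr2 sqr_ge0.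
Qed.

Lemma continuous_enorm_sub x : continuous (fun v => enorm (x - v)).
Proof.
have cdot : continuous (fun v => dot (x - v) (x - v)).
  rewrite /dot; apply: (continuous_big add_continuous) => i _ v.
  have cx : {for v, continuous (fun v : 'rV[R]_N => (x - v) 0 i)}.
    under [X in {for v, continuous X}]eq_fun do rewrite !mxE.
    by apply: continuousB; [exact: cst_continuous|exact: coord_continuous].
  exact: continuousM.
move=> v; apply: (continuous_comp (cdot v)); exact: sqrt_continuous.
Qed.

(** Only the points of [A] in a box around [x] compete, and they form a compact
    set, on which the continuous distance to [x] attains its minimum. *)
Lemma closest_exists A x : closed A -> A !=set0 -> closest A x !=set0.
Proof.
move=> clA [a Aa]; pose d := enorm (x - a).
pose box := [set v : 'rV[R]_N | forall i,
    `[x 0 i - d, x 0 i + d]%classic (v 0 i)].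
have in_box v : enorm (x - v) <= d -> box v.
  move=> dv i; have := le_trans (ler_coord_enorm (x - v) i) dv.
  by rewrite !mxE ler_norml /= in_itv /= => /andP[? ?]; apply/andP; split; lra.
have cbox : compact (box `&` A).
  apply: compact_closedI => //.
  apply: (@rV_compact _ _ (fun i => `[x 0 i - d, x 0 i + d]%classic)) => i.
  exact: segment_compact.
have [|p /set_mem[_ Ap] pmin] := EVT_min_rV (ex_intro _ a _) cbox
    (continuous_subspaceT (@continuous_enorm_sub x)).
  by split=> //; exact: in_box.
exists p; split=> // q Aq.
have [/in_box boxq|/ltW dq] := leP (enorm (x - q)) d.
  by apply: pmin; rewrite inE.
by apply: le_trans dq; apply: pmin; rewrite inE; split=> //; exact: in_box.
Qed.

Lemma closest_proj_onto A x :
  closed A -> A !=set0 -> closest A x (proj_onto A x).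
Proof. by move=> clA A0; apply: xgetPex; exact: closest_exists. Qed.

(** The variational inequality of the projection: moving from [p] towards [q]
    stays in [A], so it cannot decrease the distance to [x] at first order. *)
Lemma dot_closest_le0 A x p q :
  convex_set A -> closest A x p -> A q -> dot (x - p) (q - p) <= 0.
Proof.
move=> cvxA [Ap pmin] Aq; rewrite leNgt; apply/negP.
set c := dot _ _ => c_gt0; pose e := dot (q - p) (q - p).
have e_ge0 : 0 <= e by exact: dot_ge0.
(* If the product c were positive, this step towards q would be short enough
   for the gain 2 l c to exceed the second order term l^2 e. *)
pose l := c / (c + e).
have l_gt0 : 0 < l by rewrite divr_gt0 ?ltr_wpDr.
have l_le1 : l <= 1 by rewrite ler_pdivrMr ?mul1r ?lerDl// ltr_wpDr.
have Apq : A (l *: q + (1 - l) *: p).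
  exact: set_mem (cvxA q p (Itv01 (ltW l_gt0) l_le1) (mem_set Aq) (mem_set Ap)).
have := pmin _ Apq.
have -> : x - (l *: q + (1 - l) *: p) = (x - p) - l *: (q - p).
  by apply/rowP => i; rewrite !mxE; ring.
rewrite ler_enorm sqr_dot_subZ -/c -/e => h.
have lce : l * (c + e) = c by rewrite divfK// gt_eqF// ltr_wpDr.
have : 2 * c <= l * e by rewrite -(ler_pM2l l_gt0); lra.
have : 0 < l * c by rewrite mulr_gt0.
lra.
Qed.

(** The angle at [p] between [x] and [q] is obtuse, so the side opposite to it
    is the longest one. *)
Lemma enorm_closest_sub_le A x p q :
  convex_set A -> closest A x p -> A q -> enorm (p - q) <= enorm (x - q).
Proof.
move=> cvxA xp Aq; have := dot_closest_le0 cvxA xp Aq.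
have -> : enorm (x - q) = enorm ((x - p) - 1 *: (q - p)).
  by congr enorm; apply/rowP => i; rewrite !mxE; ring.
rewrite enorm_subC ler_enorm sqr_dot_subZ.
by have := dot_ge0 (x - p); lra.
Qed.

End EuclideanGeometry.

(** * One projected subgradient step *)

Section ProjectedSubgradient.
Context {R : realType} {N : nat}.
Local Set Implicit Arguments.
Local Unset Strict Implicit.
Variables (W : set 'rV[R]_N) (F : 'rV[R]_N -> R) (g : 'rV[R]_N -> 'rV[R]_N).
Variables (G L : R).
Hypothesis subgradF : subgradient_on W F g.
Hypothesis bounded_g : forall w, W w -> enorm (g w) <= G.

(** Expanding the square, the cross term is controlled by the subgradient
    inequality between [w] and [p].  Projection comes later, so that this also
    applies to steps that leave [W]. *)
Lemma sqr_enorm_subgradient_step_le (a : R) w p : 0 <= a -> W w -> W p ->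
  enorm (w - a *: g w - p) ^+ 2 <=
  enorm (w - p) ^+ 2 - 2 * a * (F w - F p) + (a * G) ^+ 2.
Proof.
move=> a_ge0 Ww Wp.
have -> : w - a *: g w - p = (w - p) - a *: g w by rewrite addrAC.
rewrite !sqr_enorm sqr_dot_subZ [dot _ (g w)]dotC.
have : a * (F w - F p) <= a * dot (g w) (w - p).
  by apply: ler_wpM2l => //; have := subgradF Ww Wp; rewrite dot_subC; lra.
have : a ^+ 2 * dot (g w) (g w) <= a ^+ 2 * G ^+ 2.
  apply: ler_wpM2l; first exact: sqr_ge0.
  have gG := bounded_g Ww; have G_ge0 := le_trans (enorm_ge0 _) gG.
  by rewrite -sqr_enorm ler_sqr ?nnegrE ?enorm_ge0.
by rewrite exprMn; lra.
Qed.

Hypothesis closedW : closed W.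
Hypothesis convexW : convex_set W.

Lemma psg_step_in (a : R) w : W w -> W (psg_step W g a w).
Proof.
move=> Ww.
by have [] := closest_proj_onto (w - a *: g w) closedW (ex_intro _ w Ww).
Qed.

Lemma iter_psg_step_in (a : R) w n : W w -> W (iter n (psg_step W g a) w).
Proof. by move=> Ww; elim: n => //= n; exact: psg_step_in. Qed.

Lemma frames_in T w0 k : W w0 -> W (frames W g T w0 k).
Proof. by move=> Ww0; elim: k => //= k; exact: iter_psg_step_in. Qed.

Hypothesis closedWstar : closed (minimizers W F).
Hypothesis minF : min_attained W F.

Local Notation Wstar := (minimizers W F).
Local Notation dist w := (enorm (w - proj_onto Wstar w)).

Lemma minimizers_nonempty : Wstar !=set0.
Proof.
have [w Ww wmin] := minF; exists w; split=> //; apply/eqP.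
have lbw : lbound (F @` W) (F w) by move=> _ [w' Ww' <-]; exact: wmin.
rewrite eq_le lb_le_inf //=; last by exists (F w), w.
by apply: ge_inf; [exists (F w)|exists w].
Qed.

Lemma closest_minimizer w : closest Wstar w (proj_onto Wstar w).
Proof. exact: closest_proj_onto closedWstar minimizers_nonempty. Qed.

Hypothesis L_gt0 : 0 < L.
Hypothesis sharpF : forall w, W w -> L * dist w <= F w - Fmin W F.

(** A function cannot grow faster than its subgradients allow.  Here this is
    read off the squared distance to the minimizer, which stays nonnegative
    after a well-chosen step. *)
Lemma sharp_slope_le w : W w -> 0 < dist w -> L <= G.
Proof.
move=> Ww d_gt0; have [[Wp Fp] _] := closest_minimizer w.
have G_ge0 : 0 <= G := le_trans (enorm_ge0 _) (bounded_g Ww).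
have Ld := sharpF Ww; rewrite -Fp in Ld.
(* With d = dist w, the step d / L makes d^2 - 2 a L d + (a L)^2 vanish, so
   the same expression with (a G)^2 is negative when G < L. *)
have a_gt0 : 0 < dist w / L by rewrite divr_gt0.
have := sqr_enorm_subgradient_step_le (ltW a_gt0) Ww Wp.
move/(le_trans (sqr_ge0 _)) => h.
have := ler_wpM2l (ltW a_gt0) Ld; rewrite /= mulrA divfK ?gt_eqF// -expr2 => h'.
have {h h'} : dist w ^+ 2 <= (dist w / L * G) ^+ 2 by lra.
rewrite ler_sqr ?nnegrE ?mulr_ge0 ?invr_ge0 ?enorm_ge0 ?(ltW L_gt0)//.
by rewrite -mulrA ler_pMr// mulrC ler_pdivlMr// mul1r.
Qed.

(** The minimizer closest to [w] is used as the reference point after the step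
    too; the distance to the set of minimizers can only be smaller. *)
Lemma sqr_dist_psg_step_le (a : R) w : 0 <= a -> W w ->
  dist (psg_step W g a w) ^+ 2 <=
  dist w ^+ 2 - 2 * a * L * dist w + (a * G) ^+ 2.
Proof.
move=> a_ge0 Ww; have [[Wp Fp] _] := closest_minimizer w.
set p := proj_onto _ w in Wp Fp *; set w' := psg_step W g a w.
have [_ /(_ p) w'min] := closest_minimizer w'.
have xw' : closest W (w - a *: g w) w'.
  by apply: closest_proj_onto => //; exists w.
have le1 := enorm_closest_sub_le convexW xw' Wp.
have le2 : dist w' <= enorm (w - a *: g w - p).
  by apply: le_trans le1; exact: w'min.
have le3 := sqr_enorm_subgradient_step_le a_ge0 Ww Wp.
have Ld := sharpF Ww; rewrite -Fp -/p in Ld.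
have aLd := ler_wpM2l a_ge0 Ld.
have : dist w' ^+ 2 <= enorm (w - a *: g w - p) ^+ 2.
  by rewrite ler_sqr ?nnegrE ?enorm_ge0.
lra.
Qed.

End ProjectedSubgradient.

(** * The scalar recursion for the distance *)

Section StepRecursion.
Context {R : realType}.
Local Set Implicit Arguments.
Local Unset Strict Implicit.
Implicit Types a d G L Z : R.

(** For [d] above the threshold [b = a G ^ 2 / L], the noise [(a G) ^ 2 = a L b]
    absorbs at most half of the decrease [2 a L d], and the rest is at least the
    decrease of [d ^ 2] to [(d - a L / 2) ^ 2].  Below it, the bound is convex
    in [d], hence largest at an end of the interval from [0] to [b], and at both
    ends it is at most [b ^ 2] because [a L <= b]. *)
Lemma sharp_step_le a d d' G L :
  0 <= a -> 0 < L -> L <= G -> 0 <= d -> 0 <= d' ->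
  d' ^+ 2 <= d ^+ 2 - 2 * a * L * d + (a * G) ^+ 2 ->
  d' <= Num.max (a * (G ^+ 2 / L)) (d - a * L / 2).
Proof.
move=> a_ge0 L_gt0 leLG d_ge0 d'_ge0 hd'; set b := a * _.
have G_gt0 : 0 < G := lt_le_trans L_gt0 leLG.
have bL : b * L = a * G ^+ 2 by rewrite -mulrA divfK ?gt_eqF.
have leab : a * L <= b.
  rewrite ler_wpM2l// ler_pdivlMr// -expr2.
  by rewrite ler_sqr ?nnegrE ?(ltW L_gt0) ?(ltW G_gt0).
have aL_ge0 : 0 <= a * L by rewrite mulr_ge0// ltW.
have aG2 : (a * G) ^+ 2 = a * L * b by rewrite -mulrA [L * b]mulrC bL; ring.
rewrite aG2 in hd'; rewrite le_max; have [led|ltd] := leP b d.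
  apply/orP; right; rewrite -ler_sqr ?nnegrE //; last by lra.
  by have := ler_wpM2l aL_ge0 led; have := sqr_ge0 (a * L); nra.
by apply/orP; left; rewrite -ler_sqr ?nnegrE //; [nra|lra].
Qed.

Lemma iter_sharp_step_le (d : nat -> R) a G L n :
  0 <= a -> 0 < L ->
  (forall k, d k.+1 <= Num.max (a * (G ^+ 2 / L)) (d k - a * L / 2)) ->
  d n <= Num.max (a * (G ^+ 2 / L)) (d 0%N - n%:R * (a * L / 2)).
Proof.
move=> a_ge0 L_gt0 step; have c_ge0 : 0 <= a * L / 2.
  by rewrite divr_ge0// mulr_ge0// ltW.
elim: n => [|n IH]; first by rewrite mul0r subr0 le_max lexx orbT.
apply: le_trans (step n) _; rewrite ge_max le_max lexx /= le_max.
move: IH; rewrite le_max => /orP[h|h]; apply/orP; [left|right].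
  by lra.
by rewrite -[n.+1%:R]natr1 mulrDl mul1r; lra.
Qed.

End StepRecursion.

(** * The constants of the algorithm *)

Section Constants.
Context {R : realType}.
Local Set Implicit Arguments.
Local Unset Strict Implicit.

Lemma theta_gt0 (L G Z : R) : 0 < Z -> 0 < theta L G Z.
Proof. by move=> Z_gt0; rewrite /theta lt_max Z_gt0 orbT. Qed.

Variables (L G : R).
Hypotheses (L_gt0 : 0 < L) (leLG : L <= G).

Let G_gt0 : 0 < G. Proof. exact: lt_le_trans L_gt0 leLG. Qed.

Let den_gt0 : 0 < 24 * G ^+ 2 + 2 * L * G.
Proof. by rewrite addr_gt0// !mulr_gt0. Qed.

Lemma r_P_gt0 : 0 < r_P L G.
Proof. by rewrite divr_gt0// mulr_gt0. Qed.

Lemma subr_rho_P : 1 - rho_P L G = L * r_P L G / 4.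
Proof.
by rewrite /rho_P /r_P; field; rewrite gt_eqF.
Qed.

Lemma Lr_P_le : L * r_P L G <= 1 / 8.
Proof.
rewrite /r_P mulrA ler_pdivrMr//.
have : 0 < L * G by rewrite mulr_gt0.
have : L ^+ 2 <= G ^+ 2 by rewrite ler_sqr ?nnegrE ?(ltW L_gt0) ?(ltW G_gt0).
by lra.
Qed.

Lemma G2L_r_P_le : G ^+ 2 / L * r_P L G <= 1 / 8.
Proof.
have -> : G ^+ 2 / L * r_P L G = 3 * G ^+ 2 / (24 * G ^+ 2 + 2 * L * G).
  by rewrite /r_P; field; rewrite !gt_eqF.
by rewrite ler_pdivrMr//; have : 0 < L * G := mulr_gt0 L_gt0 G_gt0; lra.
Qed.

Lemma rho_P_lt1 : rho_P L G < 1.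
Proof. by rewrite -subr_gt0 subr_rho_P divr_gt0// mulr_gt0// r_P_gt0. Qed.

Lemma D_P_ge0 : 0 <= D_P L G.
Proof.
have rG : 0 <= 2 * G * r_P L G.
  by apply: mulr_ge0 (ltW r_P_gt0); rewrite mulr_ge0// ltW.
have e1 := expR_ge1Dx (2 * G * r_P L G); have rho1 := rho_P_lt1.
rewrite divr_ge0 ?mulr_ge0 ?expR_ge0 ?subr_ge0 ?(ltW rho1)//.
by lra.
Qed.

(** As [D_P >= 0], the constant [U_P] is at least [2 / r_P ^ 2], while
    [G ^ 2 / L] is at most [1 / (8 r_P)]. *)
Lemma theta_ge Z : G ^+ 2 / L <= theta L G Z.
Proof.
have b_ge0 : 0 <= G ^+ 2 / L by rewrite divr_ge0 ?sqr_ge0 ?(ltW L_gt0).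
have r_gt0 := r_P_gt0.
rewrite /theta le_max; apply/orP; left.
rewrite -[leLHS](ger0_norm b_ge0) -sqrtr_sqr ler_wsqrtr// /U_P.
rewrite ler_pdivlMr ?exprn_gt0// -exprMn.
have br := G2L_r_P_le; have D0 := D_P_ge0.
have br0 : 0 <= G ^+ 2 / L * r_P L G by rewrite mulr_ge0// ltW.
have : (G ^+ 2 / L * r_P L G) ^+ 2 <= 1 by rewrite exprn_ile1//; lra.
by lra.
Qed.

(** Since [ln (1 / rho) <= (1 - rho) / rho] and [1 - rho_P] is a quarter of
    [L r_P], the bound [ln (1 / rho_P) <= L r_P] follows from [rho_P >= 1 / 4],
    which holds because [L r_P] is small. *)
Lemma frame_size_ge Z : 0 < Z ->
  2 * theta L G Z / L <= (frame_size L G Z)%:R.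
Proof.
move=> Z_gt0; have th_gt0 := theta_gt0 L G Z_gt0.
have rho1 := rho_P_lt1; have Lr := Lr_P_le; have rhoE := subr_rho_P.
have Lr_gt0 : 0 < L * r_P L G by rewrite mulr_gt0// r_P_gt0.
have rho_gt0 : 0 < rho_P L G by lra.
have ln_gt0 : 0 < ln (rho_P L G)^-1 by rewrite ln_gt0// invf_gt1.
have ln_le : ln (rho_P L G)^-1 <= L * r_P L G.
  apply: (@le_trans _ _ ((rho_P L G)^-1 - 1)).
    rewrite -[X in ln X](subrKC 1); apply: le_ln1Dx.
    by rewrite ltrBrDl subrr invr_gt0.
  by rewrite lerBlDr -[leLHS]mul1r ler_pdivrMr//; nra.
rewrite /frame_size natr_absz intr_norm.
apply: le_trans _ (ler_norm _); apply: le_trans _ (ceil_ge _).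
rewrite ler_pdivlMr//.
apply: le_trans (ler_wpM2l _ ln_le) _.
  by rewrite divr_ge0 ?mulr_ge0 ?ltW.
rewrite le_eqVlt; apply/orP; left; apply/eqP; field.
by rewrite gt_eqF.
Qed.

End Constants.

(** * Frames *)

Section Frames.
Context {R : realType} {N : nat}.
Local Set Implicit Arguments.
Local Unset Strict Implicit.
Variables (W : set 'rV[R]_N) (F : 'rV[R]_N -> R) (g : 'rV[R]_N -> 'rV[R]_N).
Variables (G L th : R) (T : nat).
Hypothesis subgradF : subgradient_on W F g.
Hypothesis bounded_g : forall w, W w -> enorm (g w) <= G.
Hypothesis closedW : closed W.
Hypothesis convexW : convex_set W.
Hypothesis closedWstar : closed (minimizers W F).
Hypothesis minF : min_attained W F.
Hypothesis L_gt0 : 0 < L.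

Local Notation Wstar := (minimizers W F).
Local Notation dist w := (enorm (w - proj_onto Wstar w)).

Hypothesis sharpF : forall w, W w -> L * dist w <= F w - Fmin W F.
Hypothesis leLG : L <= G.
Hypothesis th_ge : G ^+ 2 / L <= th.
Hypothesis T_ge : 2 * th / L <= T%:R.

(** The length of a frame is what the steady decrease by [a L / 2] takes to
    cover [a th]; if the distance drops to [a G ^ 2 / L] earlier, it stays
    there. *)
Lemma dist_frame_le (a : R) w : 0 <= a -> W w -> dist w <= 2 * a * th ->
  dist (iter T (psg_step W g a) w) <= a * th.
Proof.
move=> a_ge0 Ww dw; pose wk k := iter k (psg_step W g a) w.
have Wwk k : W (wk k) by exact: iter_psg_step_in.
have step k := sharp_step_le a_ge0 L_gt0 leLG (enorm_ge0 _) (enorm_ge0 _)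
  (sqr_dist_psg_step_le subgradF bounded_g closedW convexW closedWstar minF
    sharpF a_ge0 (Wwk k)).
have := iter_sharp_step_le (d := fun k => dist (wk k)) T a_ge0 L_gt0 step.
move/le_trans; apply; rewrite ge_max ler_wpM2l//=.
have : th <= T%:R * (L / 2).
  by rewrite mulrA ler_pdivlMr// -ler_pdivrMr// [th * 2]mulrC.
move/(ler_wpM2l a_ge0) => /=.
by lra.
Qed.

(** Frame [k + 1] has step size [2 ^- (k + 1)], half of the factor [2 ^- k] left
    by the preceding frames: this is the factor 2 in [dist_frame_le]. *)
Lemma dist_frames_le w0 k : W w0 -> dist w0 <= th ->
  dist (frames W g T w0 k) <= th * 2 ^- k.
Proof.
move=> Ww0 dw0; elim: k => [|k IH] /=; first by rewrite expr0 invr1 mulr1.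
rewrite mulrC; apply: dist_frame_le; first by rewrite invr_ge0 exprn_ge0.
  exact: frames_in.
by apply: le_trans IH _; rewrite exprS invfM mulrA divff ?mul1r; lra.
Qed.

End Frames.

Theorem theorem3 (R : realType) (N : nat) (W : set 'rV[R]_N)
    (F : 'rV[R]_N -> R) (g : 'rV[R]_N -> 'rV[R]_N)
    (G L_P H Z : R) (w0 : 'rV[R]_N) (M : nat)
    (closedW : closed W)
    (convexW : convex_set W)
    (contF : {within W, continuous F})
    (convexF : convex_function W F)
    (subgradF : subgradient_on W F g)
    (minF : min_attained W F)
    (closedWstar : closed (minimizers W F))
    (bounded_g : forall w, W w -> enorm (g w) <= G)
    (L_P_gt0 : 0 < L_P)
    (polyhedralF : forall w, W w ->
       L_P * enorm (w - proj_onto (minimizers W F) w) <= F w - Fmin W F)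
    (H_gt0 : 0 < H)
    (lipschitzF : forall w w', W w -> W w' ->
       `|F w - F w'| <= H * enorm (w - w'))
    (Z_gt0 : 0 < Z)
    (Ww0 : W w0)
    (w0_near : enorm (w0 - proj_onto (minimizers W F) w0) <= Z)
    (M_gt0 : (0 < M)%N) :
  let wM := frames W g (frame_size L_P G Z) w0 M in
  enorm (wM - proj_onto (minimizers W F) wM) <= theta L_P G Z * 2 ^- M /\
  F wM - Fmin W F <= theta L_P G Z * H * 2 ^- M.
Proof.
move=> wM.
have WwM : W wM by exact: frames_in.
have th_gt0 := theta_gt0 L_P G Z_gt0.
have dwM : enorm (wM - proj_onto (minimizers W F) wM) <=
           theta L_P G Z * 2 ^- M.
  have [leLG|ltGL] := leP L_P G.
    apply: (dist_frames_le subgradF bounded_g closedW convexW closedWstar minF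
      L_P_gt0 polyhedralF leLG) => //.
    - exact: theta_ge.
    - exact: frame_size_ge.
    - by apply: le_trans w0_near _; rewrite /theta le_max lexx orbT.
  (* Here F is constant on W, so every iterate is a minimizer. *)
  apply: (@le_trans _ _ 0); last by rewrite mulr_ge0 ?invr_ge0 ?exprn_ge0 ?ltW.
  rewrite leNgt; apply/negP => d_gt0; move: ltGL; rewrite ltNge => /negP; apply.
  exact: (sharp_slope_le subgradF bounded_g closedWstar minF L_P_gt0
            polyhedralF WwM).
split=> //; have [[Wp <-] _] := closest_minimizer closedWstar minF wM.
apply: le_trans (ler_norm _) _; apply: le_trans (lipschitzF _ _ WwM Wp) _.
by rewrite mulrAC [leRHS]mulrC ler_pM2l.
Qed.
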